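(* Let $\Theta\subseteq\mathbb{R}$ be an interval, let $\mathbb{M}_n:\Theta\to\mathbb{R}$ be a (random) function, let $\widehat{\theta}_n := \operatorname{argmin}_{\theta\in\Theta}\mathbb{M}_n(\theta)$, let $\theta_0$ be the target of $\widehat{\theta}_n$ (as defined in the context), and let $\dot{\mathbb{M}}_n(\theta_0)$ denote (a version of) the derivative of $\mathbb{M}_n$ at $\theta_0$. If $\theta_0$ lies in the interior of $\Theta$ and $\theta\mapsto\mathbb{M}_n(\theta)$ is convex, then $$\mathrm{Med\mbox{-}bias}_{\theta_0}(\widehat{\theta}_n) ~\le~ \left(\frac{1}{2} - \min\left\{\mathbb{P}(\dot{\mathbb{M}}_n(\theta_0) < 0),\,\mathbb{P}(\dot{\mathbb{M}}_n(\theta_0) > 0)\right\}\right)_+.$$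
   Context: For a real number $x$, $(x)_+ := \max\{x,0\}$. For a real-valued estimator $\widehat{\theta}$ of $\theta_0\in\mathbb{R}$, the median bias is $$\mathrm{Med\mbox{-}bias}_{\theta_0}(\widehat{\theta}) := \left(\frac{1}{2} - \min\left\{\mathbb{P}(\widehat{\theta}\le\theta_0),\,\mathbb{P}(\widehat{\theta}\ge\theta_0)\right\}\right)_+.$$ $\mathbb{M}_n$ is a random objective function (depending on the data), and its minimizer $\widehat{\theta}_n$ over $\Theta$ is assumed to exist and to be a random variable. The target is $\theta_0 := \operatorname{argmin}_{\theta\in\Theta}M(\theta)$, where $M(\cdot)$ is the pointwise limit in probability of $\mathbb{M}_n(\cdot)$ as $n\to\infty$. The symbol $\dot{\mathbb{M}}_n$ denotes the first derivative of $\mathbb{M}_n$; when the convex function $\mathbb{M}_n$ is not differentiable at $\theta_0$, a version of the derivative means a measurable choice of a subgradient of $\mathbb{M}_n$ at $\theta_0$. *)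

(* Defs.v *)
From mathcomp Require Import all_boot all_order all_algebra.
From mathcomp Require Import all_classical all_reals all_analysis.
Import Order.TTheory GRing.Theory Num.Theory.
Import numFieldNormedType.Exports.

Set Implicit Arguments.
Unset Strict Implicit.
Unset Printing Implicit Defensive.

Local Open Scope classical_set_scope.
Local Open Scope ring_scope.

(* Functions on Theta are encoded as total functions on R; none of the notions
   below depends on the values outside Theta (for the derivative, this uses
   that the point at which it is taken is interior to Theta). *)

Definition posr (R : realType) (x : R) : R := Num.max x 0.

Definition med_bias (d : measure_display) (T : measurableType d) (R : realType)
    (P : probability T R) (theta0 : R) (X : {RV P >-> R}) : R :=
  posr (2^-1 - Num.min (fine (P [set w | X w <= theta0]))
                       (fine (P [set w | theta0 <= X w]))).

(* The set of all minimizers of f over Theta. *)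
Definition argmin (R : realType) (Theta : set R) (f : R -> R) : set R :=
  [set x | Theta x /\ forall y, Theta y -> f x <= f y].

Definition cvg_in_probability (d : measure_display) (T : measurableType d)
    (R : realType) (P : probability T R) (X : nat -> {RV P >-> R}) (c : R) :=
  forall e : R, 0 < e ->
    P [set w | e <= `|X n w - c|] @[n --> \oo] --> 0%E.

Definition is_target (d : measure_display) (T : measurableType d)
    (R : realType) (P : probability T R) (Theta : set R)
    (Mn : nat -> R -> {RV P >-> R}) (theta0 : R) :=
  exists M : R -> R,
    (forall theta, Theta theta ->
       cvg_in_probability (fun n => Mn n theta) (M theta)) /\
    argmin Theta M theta0.

Definition subgradient (R : realType) (Theta : set R) (f : R -> R) (x : R)
    : set R :=
  [set g | forall y, Theta y -> f x + g * (y - x) <= f y].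

(* g is "a version of the derivative" of f at x: the derivative itself where it
   exists, some subgradient otherwise. *)
Definition derivative_version (R : realType) (Theta : set R) (f : R -> R)
    (x g : R) :=
  (derivable f x 1 -> g = derive1 f x) /\
  (~ derivable f x 1 -> subgradient Theta f x g).

(* Main.v *)
Require Import Defs.
From mathcomp Require Import all_boot all_order all_algebra.
From mathcomp Require Import all_classical all_reals all_analysis.
From mathcomp Require Import ring lra.
Import Order.TTheory GRing.Theory Num.Theory.
Import numFieldNormedType.Exports.

(** A subgradient [g] of a convex function at [x] tells on which side of [x]
    its minimizers lie: if [g < 0], the supporting line with slope [g] is
    strictly above [f x] to the left of [x], and so is [f], hence every
    minimizer is at least [x]; the case [g > 0] is symmetric
    ([subgradient_lt0_argmin], [subgradient_gt0_argmin]).  A version of the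
    derivative of a convex function is always a subgradient, because the
    difference quotients from [x] towards [y] are bounded by the full increment
    [f y - f x] ([convex_derive_le], [derivative_version_subgradient]).
    Applied to every sample, this gives the inclusion of the event [dMn < 0]
    in [theta0 <= thetahat] and of [0 < dMn] in [thetahat <= theta0].  The
    probabilities in the median bias are therefore at least those of the signs
    of the derivative, and [posr (2^-1 - Num.min _ _)] is antitone in both. *)

Local Open Scope classical_set_scope.
Local Open Scope ring_scope.

(** For [0 < t <= 1], convexity on the segment from [x] to [y] bounds the
    difference quotient at step [t] in the direction [y - x] by its value at
    [t = 1]; the inequality survives the limit [t --> 0^'+].  Working with the
    direction [y - x] treats both sides of [x] at once. *)
Lemma convex_derive_le (R : realType) (D : set R) (f : R -> R) (x y : R) :
  convex_function D f -> D x -> D y -> derivable f x (y - x) ->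
  f x + 'D_(y - x) f x <= f y.
Proof.
move=> cvx Dx Dy dfx; rewrite addrC -lerBrDr.
have dfx_right := cvg_dnbhs_at_right dfx.
rewrite /derive -(cvg_lim _ dfx_right)//.
apply: limr_le; first by apply/cvg_ex; eexists; exact: dfx_right.
near=> t.
have t0 : 0 < t by near: t; exact: nbhs_right_gt.
have t1 : t <= 1 by near: t; exact: nbhs_right_le.
have /andP[t_ge0 t_le1] : 0 <= t <= 1 by rewrite ltW.
have := cvx (Itv01 t_ge0 t_le1) y x (mem_set Dy) (mem_set Dx).
rewrite !convRE /= /unstable.onem => cvx_t.
have -> : t *: (y - x) + x = t * y + (1 - t) * x by rewrite /GRing.scale/=; ring.
rewrite /GRing.scale/= ler_pdivrMl//; lra.
Unshelve. all: by end_near. Qed.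

Lemma derivative_version_subgradient (R : realType) (D : set R) (f : R -> R)
    (x g : R) :
  convex_function D f -> D x -> derivative_version D f x g ->
  subgradient D f x g.
Proof.
move=> cvx Dx [gE gsub].
have [dfx|/gsub//] := pselect (derivable f x 1).
move=> y Dy; have diff_fx : differentiable f x by exact/derivable1_diffP.
have -> : g * (y - x) = 'D_(y - x) f x.
  rewrite (gE dfx) derive1E !deriveE// mulrC.
  by rewrite -[in RHS](mulr1 (y - x)) -[in RHS]/((y - x) *: 1) linearZ.
by apply: (convex_derive_le _ D) => //; exact: diff_derivable.
Qed.

Lemma subgradient_lt0_argmin (R : realType) (D : set R) (f : R -> R)
    (x z g : R) :
  D x -> subgradient D f x g -> argmin D f z -> g < 0 -> x <= z.
Proof.
move=> Dx gsub [Dz zmin] g0; rewrite leNgt; apply/negP => zx.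
have := gsub z Dz; have := zmin x Dx; nra.
Qed.

Lemma subgradient_gt0_argmin (R : realType) (D : set R) (f : R -> R)
    (x z g : R) :
  D x -> subgradient D f x g -> argmin D f z -> 0 < g -> z <= x.
Proof.
move=> Dx gsub [Dz zmin] g0; rewrite leNgt; apply/negP => xz.
have := gsub z Dz; have := zmin x Dx; nra.
Qed.

Lemma posr_half_min_le (R : realType) (a b a' b' : R) :
  a' <= a -> b' <= b ->
  posr (2^-1 - Num.min a b) <= posr (2^-1 - Num.min a' b').
Proof.
move=> a'a b'b; rewrite /posr ge_max !le_max lexx orbT andbT.
by rewrite lerB// le_min !ge_min a'a b'b orbT.
Qed.

Theorem theorem1 (d : measure_display) (T : measurableType d) (R : realType)
    (P : probability T R) (Theta : set R) (Mn : nat -> R -> {RV P >-> R})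
    (theta0 : R) (n : nat) (thetahat dMn : {RV P >-> R}) :
  is_interval Theta ->
  is_target Theta Mn theta0 ->
  (forall w : T, argmin Theta (fun theta => Mn n theta w) (thetahat w)) ->
  (forall w : T,
     derivative_version Theta (fun theta => Mn n theta w) theta0 (dMn w)) ->
  interior Theta theta0 ->
  (forall w : T, convex_function Theta (fun theta => Mn n theta w)) ->
  med_bias theta0 thetahat <=
    posr (2^-1 - Num.min (fine (P [set w | dMn w < 0]))
                         (fine (P [set w | 0 < dMn w]))).
Proof.
move=> _ _ hatmin dver /interior_subset theta0in cvx.
have dsub w : subgradient Theta (fun theta => Mn n theta w) theta0 (dMn w).
  exact: derivative_version_subgradient.
have mitv (X : {RV P >-> R}) (I : interval R) :
    measurable [set w | X w \in I].
  exact: (measurable_funPTI X (measurable_itv I)).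
have fine_le_event (A B : set T) : measurable A -> measurable B ->
    A `<=` B -> fine (P A) <= fine (P B).
  move=> mA mB AB; apply: fine_le; rewrite ?fin_num_measure//.
  by apply: le_measure; rewrite ?inE.
have mle (X : {RV P >-> R}) c : measurable [set w | X w <= c].
  by have := mitv X `]-oo, c]; under eq_set do rewrite in_itv/=.
have mlt (X : {RV P >-> R}) c : measurable [set w | X w < c].
  by have := mitv X `]-oo, c[; under eq_set do rewrite in_itv/=.
have mge (X : {RV P >-> R}) c : measurable [set w | c <= X w].
  by have := mitv X `[c, +oo[;
    under eq_set do rewrite in_itv/= andbT.
have mgt (X : {RV P >-> R}) c : measurable [set w | c < X w].
  by have := mitv X `]c, +oo[;
    under eq_set do rewrite in_itv/= andbT.
(* The event on the positive sign is the one bounding P(thetahat <= theta0),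
   hence the swap. *)
rewrite /med_bias [Num.min (fine (P [set w | dMn w < 0])) _]minC.
apply: posr_half_min_le; apply: fine_le_event => // w /= dw.
- exact: (subgradient_gt0_argmin _ _ _ _ _ _ _ (dsub w) (hatmin w) dw).
- exact: (subgradient_lt0_argmin _ _ _ _ _ _ _ (dsub w) (hatmin w) dw).
Qed.
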